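(* Let $\mathcal{Q}=\left(\frac{u^2-1,\;v^2-1}{\mathbb{Q}(u,v)}\right)$ and $$\mathcal{O}=\{\mathbf{u}=(R,S,T,W)\in\mathcal{Q}\;:\;R,S,T,W\in\mathbb{Q}[u,v],\ N(\mathbf{u})\in\mathbb{Z}[u,v]\}.$$ Then: 1. $\mathcal{O}$ is the set of quaternions of the form $(R,S,T,W)+\tfrac12P\,\big((u+1)(v+1),\,v+1,\,u+1,\,1\big)$, where $R,S,T,W,P\in\mathbb{Z}[u,v]$. 2. $\mathcal{O}$ is the unique maximal order of $\mathcal{Q}$ (over $\mathbb{Z}[u,v]$) which contains $\mathbf{i}$ and $\mathbf{j}$.
   Context: $u,v$ are indeterminates. $\left(\frac{a,b}{F}\right)$ is the quaternion algebra over $F$ with basis $1,\mathbf{i},\mathbf{j},\mathbf{k}$, $\mathbf{i}^2=a$, $\mathbf{j}^2=b$, $\mathbf{i}\mathbf{j}=-\mathbf{j}\mathbf{i}=\mathbf{k}$; $(R,S,T,W)$ denotes $R+S\mathbf{i}+T\mathbf{j}+W\mathbf{k}$, with norm $N=R^2-aS^2-bT^2+abW^2$. For an integrally closed domain $D$ with field of fractions $F$ and a quaternion algebra $\mathcal{A}$ over $F$, an order in $\mathcal{A}$ (over $D$) is a finitely generated $D$-submodule $L$ of $\mathcal{A}$ with $FL=\mathcal{A}$ that is also a ring with $1$. *)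

(* Defs.v *)
From HB Require Import structures.
From mathcomp Require Import all_boot all_order all_algebra.
From mathcomp Require Import boolp classical_sets.
From mathcomp Require Import ring.

Set Implicit Arguments.
Unset Strict Implicit.
Unset Printing Implicit Defensive.

Import GRing.Theory.
Local Open Scope classical_set_scope.
Local Open Scope ring_scope.

Record quat (F : fieldType) (a b : F) : Type :=
  Quat { qre : F; qi_ : F; qj_ : F; qk_ : F }.

Section Quaternions.
Variables (F : fieldType) (a b : F).
Local Notation Q := (quat a b).
Local Notation mk := (@Quat F a b).
Implicit Types x y z : Q.

Definition quat_tuple x : F * F * F * F := (qre x, qi_ x, qj_ x, qk_ x).
Definition tuple_quat (t : F * F * F * F) : Q :=
  mk t.1.1.1 t.1.1.2 t.1.2 t.2.

Lemma quat_tupleK : cancel quat_tuple tuple_quat.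
Proof. by case. Qed.

HB.instance Definition _ := Choice.copy Q (can_type quat_tupleK).

Lemma quatP x y :
  [/\ qre x = qre y, qi_ x = qi_ y, qj_ x = qj_ y & qk_ x = qk_ y] <-> x = y.
Proof. by split=> [|->//]; case: x y => [? ? ? ?] [? ? ? ?] /= [-> -> -> ->]. Qed.

Definition quat_zero : Q := mk 0 0 0 0.
Definition quat_one : Q := mk 1 0 0 0.
Definition quat_opp x : Q := mk (- qre x) (- qi_ x) (- qj_ x) (- qk_ x).
Definition quat_add x y : Q :=
  mk (qre x + qre y) (qi_ x + qi_ y) (qj_ x + qj_ y) (qk_ x + qk_ y).
Definition quat_scale (c : F) x : Q :=
  mk (c * qre x) (c * qi_ x) (c * qj_ x) (c * qk_ x).
(* The bilinear product with i^2 = a, j^2 = b, ij = k = -ji; see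
   [quat_i_sqr], [quat_j_sqr], [quat_ij] and [quat_ji] below. *)
Definition quat_mul x y : Q :=
  let: Quat x0 x1 x2 x3 := x in
  let: Quat y0 y1 y2 y3 := y in
  mk (x0 * y0 + a * x1 * y1 + b * x2 * y2 - a * b * x3 * y3)
     (x0 * y1 + x1 * y0 - b * x2 * y3 + b * x3 * y2)
     (x0 * y2 + x2 * y0 + a * x1 * y3 - a * x3 * y1)
     (x0 * y3 + x3 * y0 + x1 * y2 - x2 * y1).

Ltac quat_ring :=
  repeat case=> [? ? ? ?]; apply/quatP; split=> /=; ring.

Fact quat_addA : associative quat_add. Proof. quat_ring. Qed.
Fact quat_addC : commutative quat_add. Proof. quat_ring. Qed.
Fact quat_add0 : left_id quat_zero quat_add. Proof. quat_ring. Qed.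
Fact quat_addN : left_inverse quat_zero quat_opp quat_add.
Proof. quat_ring. Qed.

HB.instance Definition _ :=
  GRing.isZmodule.Build Q quat_addA quat_addC quat_add0 quat_addN.

Fact quat_mulA : associative quat_mul. Proof. quat_ring. Qed.
Fact quat_mul1l : left_id quat_one quat_mul. Proof. quat_ring. Qed.
Fact quat_mul1r : right_id quat_one quat_mul. Proof. quat_ring. Qed.
Fact quat_mulDl : left_distributive quat_mul +%R. Proof. quat_ring. Qed.
Fact quat_mulDr : right_distributive quat_mul +%R. Proof. quat_ring. Qed.
Fact quat_one_neq0 : quat_one != 0.
Proof. by apply/eqP => /quatP[/= /eqP]; rewrite oner_eq0. Qed.

HB.instance Definition _ := GRing.Zmodule_isNzRing.Build Q
  quat_mulA quat_mul1l quat_mul1r quat_mulDl quat_mulDr quat_one_neq0.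

Fact quat_scaleA c d x : quat_scale c (quat_scale d x) = quat_scale (c * d) x.
Proof. by move: x; quat_ring. Qed.
Fact quat_scale1 : left_id 1 quat_scale. Proof. quat_ring. Qed.
Fact quat_scaleDr : right_distributive quat_scale +%R.
Proof. by move=> c; quat_ring. Qed.
Fact quat_scaleDl x : {morph quat_scale^~ x : c d / c + d}.
Proof. by move=> c d; move: x; quat_ring. Qed.

HB.instance Definition _ := GRing.Zmodule_isLmodule.Build F Q
  quat_scaleA quat_scale1 quat_scaleDr quat_scaleDl.

Fact quat_scaleAl (c : F) x y : c *: (x * y) = (c *: x) * y.
Proof. by move: x y; quat_ring. Qed.
HB.instance Definition _ := GRing.Lmodule_isLalgebra.Build F Q quat_scaleAl.

Fact quat_scaleAr (c : F) x y : c *: (x * y) = x * (c *: y).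
Proof. by move: x y; quat_ring. Qed.
HB.instance Definition _ := GRing.Lalgebra_isAlgebra.Build F Q quat_scaleAr.

Definition quat_i : Q := mk 0 1 0 0.
Definition quat_j : Q := mk 0 0 1 0.
Definition quat_k : Q := mk 0 0 0 1.

Lemma quat_i_sqr : quat_i * quat_i = a%:A. Proof. quat_ring. Qed.
Lemma quat_j_sqr : quat_j * quat_j = b%:A. Proof. quat_ring. Qed.
Lemma quat_ij : quat_i * quat_j = quat_k. Proof. quat_ring. Qed.
Lemma quat_ji : quat_j * quat_i = - quat_k. Proof. quat_ring. Qed.
Lemma quatE (R S T W : F) :
  mk R S T W = R%:A + S *: quat_i + T *: quat_j + W *: quat_k.
Proof. quat_ring. Qed.

Definition quat_norm x : F :=
  qre x ^+ 2 - a * qi_ x ^+ 2 - b * qj_ x ^+ 2 + a * b * qk_ x ^+ 2.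

End Quaternions.

Section Orders.
(* [iota] is the inclusion of a domain D in its field of fractions F (see
   [ofZuv_inj] and [ofZuv_frac] for the instance used here). *)
Variables (D : idomainType) (F : fieldType) (iota : {rmorphism D -> F}).
Variable A : algType F.
Implicit Types L M : set A.

Definition submodule L : Prop :=
  [/\ L 0, (forall x y, L x -> L y -> L (x + y)) &
      forall (c : D) x, L x -> L (iota c *: x)].

Definition finitely_generated L : Prop :=
  exists (n : nat) (g : 'I_n -> A),
    L = [set x | exists c : 'I_n -> D, x = \sum_(i < n) iota (c i) *: g i].

Definition Fspan L : set A :=
  [set x | exists (n : nat) (c : 'I_n -> F) (l : 'I_n -> A),
     (forall i, L (l i)) /\ x = \sum_(i < n) c i *: l i].

Definition is_order L : Prop :=
  [/\ submodule L, finitely_generated L, Fspan L = setT,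
      L 1 & forall x y, L x -> L y -> L (x * y)].

Definition is_maximal_order L : Prop :=
  is_order L /\ forall M, is_order M -> L `<=` M -> M = L.

End Orders.

Lemma fraction_quot (R : idomainType) (x : {fraction R}) :
  exists n, exists2 m : R, m != 0 & x = tofrac n / tofrac m.
Proof.
elim/quotW: x => r; exists \n_r, \d_r; first exact: denom_ratioP.
have dF : tofrac \d_r != 0 by rewrite tofrac_eq0 denom_ratioP.
apply: (mulIf dF); rewrite divfK //; unlock tofrac.
rewrite -[LHS]FracField.pi_mul; apply/eqmodP => /=.
rewrite FracField.equivfE /= /FracField.mulf.
rewrite !numden_Ratio ?(oner_eq0, mul1r, mulr1, mulf_neq0, denom_ratioP) //.
by rewrite mulrC.
Qed.

Section TheAlgebra.

Local Notation "x %:F" := (tofrac x).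

(* Z[u,v] and Q[u,v] are iterated polynomial rings, u being the inner variable
   and v the outer one. *)
Definition Zuv : idomainType := {poly {poly int}}.
Definition Quv : idomainType := {poly {poly rat}}.
Definition QQuv : fieldType := {fraction Quv}.

Definition ofQuv : {rmorphism Quv -> QQuv} := @tofrac Quv.
Definition Zuv_Quv : {rmorphism Zuv -> Quv} :=
  map_poly (map_poly (intr : int -> rat)).
Definition ofZuv : {rmorphism Zuv -> QQuv} := ofQuv \o Zuv_Quv.

Lemma Zuv_Quv_inj : injective Zuv_Quv.
Proof.
apply: map_inj_poly (rmorph0 _); apply: map_inj_poly (rmorph0 _).
exact: intr_inj.
Qed.

Lemma ofZuv_inj : injective ofZuv.
Proof.
move=> p q /= /eqP; rewrite tofrac_eq => /eqP; exact: Zuv_Quv_inj.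
Qed.

Lemma Quv_clear_denom (p : Quv) :
  exists2 d : Zuv, d != 0 & exists q : Zuv, Zuv_Quv q = Zuv_Quv d * p.
Proof.
elim/poly_ind: p => [|p c [d d0 [q Eq]]].
  by exists 1; rewrite ?oner_neq0 //; exists 0; rewrite mulr0 rmorph0.
have [r [a a0 Ec]] := rat_poly_scale c.
exists (d * (a%:P)%:P); first by rewrite mulf_neq0 // !polyC_eq0.
exists (q * (a%:P)%:P * 'X + d * r%:P).
have Er : Zuv_Quv (r%:P) = Zuv_Quv ((a%:P)%:P) * c%:P.
  rewrite /= !map_polyC /= Ec /= map_polyC /= -polyCM; congr _%:P.
  by rewrite mul_polyC scalerA divff ?scale1r // intr_eq0.
have EX : Zuv_Quv 'X = 'X by rewrite /= map_polyX.
by rewrite !rmorphD !rmorphM Er Eq EX; ring.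
Qed.

Lemma ofZuv_frac (x : QQuv) :
  exists p q : Zuv, q != 0 /\ x = ofZuv p / ofZuv q.
Proof.
have [n [m m0 ->]] := fraction_quot x.
have [d d0 [q Eq]] := Quv_clear_denom n.
have [e e0 [r Er]] := Quv_clear_denom m.
have inj0 (p : Zuv) : p != 0 -> ofZuv p != 0.
  by move=> p0; rewrite -(rmorph0 ofZuv) (inj_eq ofZuv_inj).
have r0 : r != 0.
  apply/eqP => r0; move/eqP: Er; rewrite r0 rmorph0 eq_sym mulf_eq0 (negPf m0).
  by rewrite orbF -(rmorph0 Zuv_Quv) (inj_eq Zuv_Quv_inj) (negPf e0).
exists (e * q), (d * r); split; first by rewrite mulf_neq0.
have Fq : ofZuv q = ofZuv d * n%:F by rewrite /= Eq rmorphM.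
have Fr : ofZuv r = ofZuv e * m%:F by rewrite /= Er rmorphM.
have mF : m%:F != 0 :> QQuv by rewrite tofrac_eq0.
have simpl_frac (K : fieldType) (N M s t : K) :
    M != 0 -> s != 0 -> t != 0 -> N / M = t * (s * N) / (s * (t * M)).
  by move=> M0 s0 t0; field; rewrite M0 s0 t0.
by rewrite (rmorphM ofZuv e) (rmorphM ofZuv d) Fq Fr; apply: simpl_frac; rewrite ?inj0.
Qed.

Definition ivar_u : QQuv := ofQuv ('X%:P).
Definition ivar_v : QQuv := ofQuv 'X.

Definition calQ := quat (ivar_u ^+ 2 - 1) (ivar_v ^+ 2 - 1).
Definition mkQ (R S T W : QQuv) : calQ := Quat _ _ R S T W.

Definition calO : set calQ :=
  [set x | exists R S T W : Quv,
     x = mkQ (ofQuv R) (ofQuv S) (ofQuv T) (ofQuv W) /\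
     exists p : Zuv, quat_norm x = ofZuv p].

End TheAlgebra.

(* Main.v *)
Require Import Defs.
From mathcomp Require Import all_boot all_order all_algebra.
From mathcomp Require Import boolp classical_sets.
From mathcomp Require Import ring zify.
Set Implicit Arguments.
Unset Strict Implicit.
Unset Printing Implicit Defensive.
Import GRing.Theory Num.Theory.
Local Open Scope classical_set_scope.
Local Open Scope ring_scope.

(** Write a = u^2 - 1, b = v^2 - 1, s = u + 1, t = v + 1 and e = (st, t, s, 1),
    a quaternion of norm 4st.

    Part 1. That R, S, T, W + P/2 e has integral norm is a computation. For the
    converse, clear denominators: n x is integral and n^2 divides its norm; the
    denominator is removed one prime at a time ([norm2_dvd_sqr]). At an odd prime
    p the norm form is anisotropic over F_p(u,v), because v^2 - 1 vanishes to
    order one at v = 1 while u^2 - 1 is not a square ([norm2_anisotropic]), so p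
    divides all four coordinates. Modulo 2 the norm is the square of
    L = R + sS + tT + stW, and looking one step further leads to the binary form
    s X^2 + st X Y + t Y^2, anisotropic over any field ([binary_anisotropic]).
    It shows that 4 | N forces the coordinates to be P e modulo 2
    ([norm2_dvd4]), and that 16 | N forces them all to be even ([norm2_dvd16]).
    So at 2 exactly the multiples of e/2 survive.

    Part 2. By part 1 the set is a lattice with basis 1, i, j, k, e/2 as
    generators, and it is a ring since the norm is multiplicative
    ([calO_order]). Conversely let M be an order containing i and j, and x in M.
    A single d in Z[u,v] clears the coordinates of all elements of M, hence
    d^2 N(x)^n is in Z[u,v] for all n; as Z[u,v] is completely integrally closed,
    N(x) is in Z[u,v] ([order_norm]), and so is the trace
    N(1 + x) - 1 - N(x). The traces of x, xi, xj, xk show that the coordinates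
    of x are polynomials over Q up to the denominators a, b and ab. These
    denominators are excluded by the integrality of N(x), again because
    u^2 - 1 and v^2 - 1 are nonsquares modulo each factor of the other
    ([dvd_ternary_form]). So every order containing i and j lies in calO
    ([order_sub_calO]), which gives both maximality and uniqueness. *)

(** * Anisotropic forms *)

Local Definition horner_ringE :=
  (hornerD, hornerN, horner_exp, hornerM, hornerX, hornerC).

(** Infinite descent on the degree. It is used with P p saying that p is a
    coordinate of some zero of a form, whence the existential predicates below. *)
Lemma poly_descent (D : idomainType) (c : D) (P : {poly D} -> Prop) :
  (forall p, P p -> exists2 q, p = q * ('X - c%:P) & P q) ->
  forall p, P p -> p = 0.
Proof.
move=> descP p; have [n] := ubnP (size p); elim: n p => // n IHn p ltpn Pp.
have [q Ep Pq] := descP p Pp.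
have [q0 | q_neq0] := eqVneq q 0; first by rewrite Ep q0 mul0r.
rewrite Ep (IHn q) ?mul0r //; move: ltpn.
by rewrite Ep size_Mmonic ?monicXsubC // size_XsubC addn2 ltnS.
Qed.

(** X^2 - 1 vanishes to order exactly one at 1, since X + 1 takes the value 2
    there, so it cannot be a square: a zero is divisible by X - 1 and the quotient
    is again a zero. *)
Lemma X2sub1_nonsquare (D : idomainType) (p q : {poly D}) :
  2 != 0 :> D -> ('X^2 - 1) * p ^+ 2 = q ^+ 2 -> p = 0 /\ q = 0.
Proof.
move=> D2.
have step (f g : {poly D}) : ('X^2 - 1) * f ^+ 2 = g ^+ 2 ->
    exists f1 g1, [/\ f = f1 * ('X - 1%:P), g = g1 * ('X - 1%:P) &
                      ('X^2 - 1) * f1 ^+ 2 = g1 ^+ 2].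
  move=> Efg.
  have /factor_theorem[g1 Eg] : root g 1.
    have /(congr1 (fun h : {poly D} => h.[1])) := Efg.
    rewrite -?polyC1 !horner_ringE expr1n subrr mul0r => /esym/eqP.
    by rewrite expf_eq0 /= rootE.
  have nz1 : 'X - 1%:P != 0 :> {poly D} by rewrite polyXsubC_eq0.
  have Ef : ('X + 1) * f ^+ 2 = ('X - 1%:P) * g1 ^+ 2.
    apply: (mulfI nz1); transitivity (('X^2 - 1) * f ^+ 2); first by ring.
    by rewrite Efg Eg; ring.
  have /factor_theorem[f1 Ef1] : root f 1.
    have /(congr1 (fun h : {poly D} => h.[1])) := Ef.
    rewrite -?polyC1 !horner_ringE subrr mul0r => /eqP.
    by rewrite mulf_eq0 (negPf D2) expf_eq0 /= rootE.
  exists f1, g1; split=> //; apply: (mulfI nz1); rewrite -Ef Ef1; ring.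
move=> Epq; split.
  apply: (@poly_descent _ 1 (fun f => exists g, ('X^2 - 1) * f ^+ 2 = g ^+ 2)).
    by move=> f [g /step[f1 [g1 [-> _ E1]]]]; exists f1 => //; exists g1.
  by exists q.
apply: (@poly_descent _ 1 (fun g => exists f, ('X^2 - 1) * f ^+ 2 = g ^+ 2)).
  by move=> g [f /step[f1 [g1 [_ -> E1]]]]; exists g1 => //; exists f1.
by exists p.
Qed.

Definition normform (R : comPzRingType) (a b x y z w : R) : R :=
  x ^+ 2 - a * y ^+ 2 - b * z ^+ 2 + a * b * w ^+ 2.

(** At X = 1 the form becomes x^2 - a y^2, so x and y are divisible by X - 1.
    Cancelling X - 1 and taking X = 1 again, where X + 1 = 2, leaves z^2 - a w^2,
    so z and w are divisible as well. *)
Lemma normform_anisotropic (D : idomainType) (a : D) (x y z w : {poly D}) :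
  2 != 0 :> D -> (forall p q : D, a * p ^+ 2 = q ^+ 2 -> p = 0 /\ q = 0) ->
  normform a%:P ('X^2 - 1) x y z w = 0 -> [/\ x = 0, y = 0, z = 0 & w = 0].
Proof.
move=> D2 a_nonsq; set N := normform _ _.
have step f g h k : N f g h k = 0 ->
    exists f1 g1 h1 k1, [/\ f = f1 * ('X - 1%:P), g = g1 * ('X - 1%:P),
      h = h1 * ('X - 1%:P), k = k1 * ('X - 1%:P) & N f1 g1 h1 k1 = 0].
  move=> EN.
  have nz1 : 'X - 1%:P != 0 :> {poly D} by rewrite polyXsubC_eq0.
  have [/factor_theorem[g1 Eg] /factor_theorem[f1 Ef]] : root g 1 /\ root f 1.
    have /(congr1 (fun h : {poly D} => h.[1])) := EN.
    rewrite /N /normform -?polyC1 !horner_ringE expr1n subrr.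
    rewrite mul0r subr0 mulr0 mul0r addr0.
    by move/eqP; rewrite subr_eq0 eq_sym => /eqP/a_nonsq[/eqP ? /eqP].
  have EN1 : ('X - 1%:P) * (f1 ^+ 2 - a%:P * g1 ^+ 2)
           = ('X + 1) * (h ^+ 2 - a%:P * k ^+ 2).
    apply/eqP; rewrite -subr_eq0; apply/eqP/(mulfI nz1); rewrite mulr0 -EN.
    by rewrite /N /normform Ef Eg; ring.
  have [/factor_theorem[k1 Ek] /factor_theorem[h1 Eh]] : root k 1 /\ root h 1.
    have /(congr1 (fun h : {poly D} => h.[1])) := EN1.
    rewrite -?polyC1 !horner_ringE subrr mul0r => /esym/eqP.
    by rewrite mulf_eq0 (negPf D2) subr_eq0 eq_sym => /eqP/a_nonsq[/eqP ? /eqP].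
  exists f1, g1, h1, k1; split=> //; apply: (mulfI nz1); rewrite mulr0.
  apply/eqP; move/eqP: EN1; rewrite -subr_eq0; congr (_ == _).
  by rewrite /N /normform Eh Ek; ring.
move=> EN; split; pose P := @poly_descent D 1.
- apply: (P (fun f => exists g h k, N f g h k = 0)); last by exists y, z, w.
  move=> f [g [h [k /step[f1 [g1 [h1 [k1 [-> _ _ _ E1]]]]]]]].
  by exists f1 => //; exists g1, h1, k1.
- apply: (P (fun g => exists f h k, N f g h k = 0)); last by exists x, z, w.
  move=> g [f [h [k /step[f1 [g1 [h1 [k1 [_ -> _ _ E1]]]]]]]].
  by exists g1 => //; exists f1, h1, k1.
- apply: (P (fun h => exists f g k, N f g h k = 0)); last by exists x, y, w.
  move=> h [f [g [k /step[f1 [g1 [h1 [k1 [_ _ -> _ E1]]]]]]]].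
  by exists h1 => //; exists f1, g1, k1.
- apply: (P (fun k => exists f g h, N f g h k = 0)); last by exists x, y, z.
  move=> k [f [g [h /step[f1 [g1 [h1 [k1 [_ _ _ -> E1]]]]]]]].
  by exists k1 => //; exists f1, g1, h1.
Qed.

(** At X = -1 only s x^2 remains, so X + 1 divides x; after cancelling X + 1
    only y^2 remains. *)
Lemma binary_anisotropic (D : idomainType) (s : D) (x y : {poly D}) :
  s != 0 ->
  s%:P * x ^+ 2 + s%:P * ('X + 1) * x * y + ('X + 1) * y ^+ 2 = 0 ->
  x = 0 /\ y = 0.
Proof.
move=> s0; pose F (f g : {poly D}) :=
  s%:P * f ^+ 2 + s%:P * ('X + 1) * f * g + ('X + 1) * g ^+ 2.
rewrite -[_ = 0]/(F x y = 0).
have EX1 : 'X + 1 = 'X - (- 1)%:P :> {poly D} by rewrite polyCN opprK.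
have nz1 : 'X + 1 != 0 :> {poly D} by rewrite EX1 polyXsubC_eq0.
have step f g : F f g = 0 ->
    exists f1 g1, [/\ f = f1 * ('X - (- 1)%:P), g = g1 * ('X - (- 1)%:P) &
                      F f1 g1 = 0].
  move=> EF.
  have /factor_theorem[f1] : root f (- 1).
    have /(congr1 (fun h : {poly D} => h.[- 1])) := EF.
    rewrite /F -?polyC1 !horner_ringE addNr !(mulr0, mul0r, addr0) => /eqP.
    by rewrite mulf_eq0 (negPf s0) expf_eq0.
  rewrite -EX1 => Ef.
  have EF1 : s%:P * ('X + 1) * f1 ^+ 2 + s%:P * ('X + 1) * f1 * g + g ^+ 2 = 0.
    by apply: (mulfI nz1); rewrite mulr0 -EF /F Ef; ring.
  have /factor_theorem[g1] : root g (- 1).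
    have /(congr1 (fun h : {poly D} => h.[- 1])) := EF1.
    rewrite -?polyC1 !horner_ringE addNr !(mulr0, mul0r, add0r) => /eqP.
    by rewrite expf_eq0.
  rewrite -EX1 => Eg; exists f1, g1; split=> //.
  by apply: (mulfI nz1); rewrite mulr0 -EF1 /F Eg; ring.
move=> EF; split.
  apply: (@poly_descent _ (- 1) (fun f => exists g, F f g = 0)).
    by move=> f [g /step[f1 [g1 [-> _ E1]]]]; exists f1 => //; exists g1.
  by exists y.
apply: (@poly_descent _ (- 1) (fun g => exists f, F f g = 0)).
  by move=> g [f /step[f1 [g1 [_ -> E1]]]]; exists g1 => //; exists f1.
by exists x.
Qed.

(** * Reduction of the norm modulo primes *)

Notation Zuv_mod p := (map_poly (map_poly (intr : int -> 'F_p))).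

Lemma Zuv_mod_eq0 p (f : {poly {poly int}}) :
  prime p -> Zuv_mod p f = 0 -> exists g, f = p%:R * g.
Proof.
move=> p_pr f0; pose divp_coef := map_poly (fun n : int => (n %/ p)%Z).
have divp0 : divp_coef 0 = 0 by rewrite /divp_coef map_poly0.
exists (map_poly divp_coef f); apply/polyP => i; apply/polyP => j.
rewrite mulr_natl !coefMn coef_map_id0 // coef_map_id0 ?div0z //.
rewrite -mulr_natr natz divzK // (dvdz_pcharf (pchar_Fp p_pr)).
by rewrite -coef_map -coef_map f0 !coef0.
Qed.

Lemma Zuv_mod_mulp p (f : {poly {poly int}}) :
  prime p -> Zuv_mod p (p%:R * f) = 0.
Proof.
by move=> p_pr; rewrite rmorphM /= !rmorph_nat -!polyC_natr pchar_Fp_0 // mul0r.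
Qed.

(** The reduced norm over R[u,v], where u is the inner variable 'X%:P. *)
Definition norm2 (R : comNzRingType) : _ -> _ -> _ -> _ -> {poly {poly R}} :=
  normform ('X%:P ^+ 2 - 1) ('X^2 - 1).

Lemma norm2_anisotropic (D : idomainType) (x y z w : {poly {poly D}}) :
  2 != 0 :> D -> norm2 x y z w = 0 -> [/\ x = 0, y = 0, z = 0 & w = 0].
Proof.
move=> D2; rewrite /norm2 -polyC1 -polyC_exp -rmorphB /= polyC1.
apply: normform_anisotropic.
  by rewrite -polyC_natr polyC_eq0.
by move=> p q; apply: X2sub1_nonsquare.
Qed.

Lemma norm2_map (R S : comNzRingType) (f : {rmorphism R -> S}) x y z w :
  map_poly (map_poly f) (norm2 x y z w) =
  norm2 (map_poly (map_poly f) x) (map_poly (map_poly f) y)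
        (map_poly (map_poly f) z) (map_poly (map_poly f) w).
Proof.
rewrite /norm2 /normform !(rmorphD, rmorphN, rmorphM, rmorphXn, rmorph1) /=.
by rewrite map_polyX map_polyC /= map_polyX.
Qed.

Lemma norm2_odd_prime p (x y z w g : {poly {poly int}}) :
  prime p -> odd p -> norm2 x y z w = p%:R * g ->
  exists x1 y1 z1 w1,
    [/\ x = p%:R * x1, y = p%:R * y1, z = p%:R * z1 & w = p%:R * w1].
Proof.
move=> p_pr p_odd /(congr1 (Zuv_mod p)).
have Fp2 : 2 != 0 :> 'F_p.
  rewrite -(dvdn_pcharf (pchar_Fp p_pr)); apply/negP => /dvdn_leq-/(_ isT).
  by case: (p) p_odd (prime_gt1 p_pr) => [|[|[]]].
rewrite norm2_map Zuv_mod_mulp //.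
case/(norm2_anisotropic Fp2).
case/Zuv_mod_eq0 => // x1 ->; case/Zuv_mod_eq0 => // y1 ->.
case/Zuv_mod_eq0 => // z1 ->; case/Zuv_mod_eq0 => // w1 ->.
by exists x1, y1, z1, w1.
Qed.

Section DyadicNorm.

Implicit Types f g h k : {poly {poly int}}.
Local Notation s := ('X%:P + 1).
Local Notation t := ('X + 1).

(** The image of s is nonzero in F_2[u], whence the anisotropy. *)
Lemma binary_mod2 f g h :
  s * f ^+ 2 + s * t * f * g + t * g ^+ 2 = 2 * h ->
  Zuv_mod 2 f = 0 /\ Zuv_mod 2 g = 0.
Proof.
move=> /(congr1 (Zuv_mod 2)).
rewrite (@Zuv_mod_mulp 2) // !(rmorphD, rmorphM, rmorphXn, rmorph1) /=.
rewrite map_polyX map_polyC /= map_polyX.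
rewrite -polyC1 -polyCD polyC1; apply: binary_anisotropic.
by rewrite -size_poly_eq0 size_XaddC.
Qed.

(** The norm is (f - sg - th - stk)^2 modulo 2, which determines f modulo 2.
    Substituting f, half the norm becomes the binary form at
    (g - tk, h - sk) modulo 2, so these two vanish modulo 2. *)
Lemma norm2_dvd4 f g h k n :
  norm2 f g h k = 4 * n ->
  exists R S T W P,
   [/\ f = 2 * R + P * (s * t), g = 2 * S + P * t, h = 2 * T + P * s &
       k = 2 * W + P].
Proof.
move=> En.
have [] : exists r, f = s * g + t * h + s * t * k + 2 * r.
  have : Zuv_mod 2 ((f - s * g - t * h - s * t * k) ^+ 2) = 0.
    (* the norm is the square plus 2 H *)
    set H := - (s ^+ 2 * g ^+ 2) + s * g ^+ 2 - t ^+ 2 * h ^+ 2 + t * h ^+ 2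
     + (2 * s * t - s ^+ 2 * t - s * t ^+ 2) * k ^+ 2 + s * f * g + t * f * h
     + s * t * f * k - s * t * g * h - s ^+ 2 * t * g * k - s * t ^+ 2 * h * k.
    have -> : (f - s * g - t * h - s * t * k) ^+ 2 = 2 * (2 * n - H).
      transitivity (norm2 f g h k - 2 * H); last by rewrite En; ring.
      by rewrite /norm2 /normform /H; ring.
    exact: (@Zuv_mod_mulp 2).
  rewrite rmorphXn /= => /eqP; rewrite expf_eq0 /= => /eqP/Zuv_mod_eq0[//|r Er].
  by exists r; rewrite -Er; ring.
move=> r Ef.
have [] : Zuv_mod 2 (g - t * k) = 0 /\ Zuv_mod 2 (h - s * k) = 0.
  (* half the value of the binary form, after replacing f and using the
     divisibility of the norm by 4 *)
  pose H := n - r ^+ 2 - s * t * g * k - s * t * h * k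
    + (s * t ^+ 2 + s ^+ 2 * t - s * t) * k ^+ 2 - s ^+ 2 * t * g * k
    - s * t ^+ 2 * h * k - r * (s * g + t * h + s * t * k).
  apply: (@binary_mod2 _ _ H).
  have nz2 : 2 != 0 :> {poly {poly int}} by rewrite -!polyC_natr !polyC_eq0.
  apply: (mulfI nz2); transitivity (2 * 2 * (H - n) + norm2 f g h k).
    by rewrite /H Ef /norm2 /normform; ring.
  by rewrite En; ring.
case/Zuv_mod_eq0 => // S ES; case/Zuv_mod_eq0 => // T ET.
exists (s * t * k + s * S + t * T + r), S, T, 0, k; rewrite -ES -ET.
split; try ring.
rewrite Ef.
have -> : g = t * k + 2 * S by rewrite -ES; ring.
have -> : h = s * k + 2 * T by rewrite -ET; ring.
ring.
Qed.

(** By [norm2_dvd4] the quaternion is 2m + Pe with m = (R,S,T,W), and its norm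
    divided by 4 is L^2 + st P L + st P^2 modulo 2, for
    L = R - sS - tT - stW. Multiplied by s this is the binary form at (L, sP),
    hence P is even. *)
Lemma norm2_dvd16 f g h k n :
  norm2 f g h k = 16 * n ->
  exists f1 g1 h1 k1, [/\ f = 2 * f1, g = 2 * g1, h = 2 * h1 & k = 2 * k1].
Proof.
move=> En.
have [|R [S [T [W [P [Ef Eg Eh Ek]]]]]] := @norm2_dvd4 f g h k (4 * n).
  by rewrite En; ring.
pose L := R - s * S - t * T - s * t * W.
pose H := - (s ^+ 2 * S ^+ 2) + s * S ^+ 2 - t ^+ 2 * T ^+ 2 + t * T ^+ 2
     + (2 * s * t - s ^+ 2 * t - s * t ^+ 2) * W ^+ 2 + s * R * S + t * R * T
     + s * t * R * W - s * t * S * T - s ^+ 2 * t * S * W - s * t ^+ 2 * T * W.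
have [_] : Zuv_mod 2 L = 0 /\ Zuv_mod 2 (s * P) = 0.
  apply: (@binary_mod2 _ _
    (s * (2 * n - H - s * t * P * (S + T + (s * t - s - t + 2) * W)))).
  have nz4 : 4 != 0 :> {poly {poly int}} by rewrite -!polyC_natr !polyC_eq0.
  apply: (mulfI nz4); transitivity (s * (norm2 f g h k + 4 *
    (- 2 * H - 2 * s * t * P * (S + T + (s * t - s - t + 2) * W))));
    last by rewrite En; ring.
  by rewrite Ef Eg Eh Ek /L /H /norm2 /normform; ring.
rewrite rmorphM /= => /eqP; rewrite mulf_eq0 rmorphD /= map_polyC rmorph1 /=.
rewrite map_polyX -polyC1 -polyCD polyC_eq0 -size_poly_eq0 size_XaddC /=.
move=> /eqP/Zuv_mod_eq0[//|P1 EP]; rewrite Ef Eg Eh Ek EP.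
exists (R + P1 * (s * t)), (S + P1 * t), (T + P1 * s), (W + P1); split; ring.
Qed.

End DyadicNorm.

(** The quaternion (x,y,z,w)/n has norm g. A prime dividing all coordinates is
    cancelled against n: odd primes always, and 2 as long as 4 | n. What remains is
    n = 1 or n = 2. The factor 2 on the left avoids the denominator of e/2. *)
Lemma norm2_dvd_sqr n (x y z w g : {poly {poly int}}) :
  (0 < n)%N -> norm2 x y z w = n%:R ^+ 2 * g ->
  exists R S T W P,
   [/\ 2 * x = n%:R * (2 * R + P * (('X%:P + 1) * ('X + 1))),
       2 * y = n%:R * (2 * S + P * ('X + 1)),
       2 * z = n%:R * (2 * T + P * ('X%:P + 1)) &
       2 * w = n%:R * (2 * W + P)].
Proof.
have [m] := ubnP n; elim: m => // m IHm in n x y z w g *.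
rewrite ltnS => le_nm n_gt0 En.
have IHdvd p : prime p -> (p %| n)%N ->
    (exists x1 y1 z1 w1,
      [/\ x = p%:R * x1, y = p%:R * y1, z = p%:R * z1 & w = p%:R * w1]) ->
    exists R S T W P,
     [/\ 2 * x = n%:R * (2 * R + P * (('X%:P + 1) * ('X + 1))),
         2 * y = n%:R * (2 * S + P * ('X + 1)),
         2 * z = n%:R * (2 * T + P * ('X%:P + 1)) &
         2 * w = n%:R * (2 * W + P)].
  move=> p_pr /dvdnP[k Dn] [x1 [y1 [z1 [w1 [Ex Ey Ez Ew]]]]].
  have k_gt0 : (0 < k)%N by case: (k) Dn n_gt0 => // ->.
  have p_gt1 := prime_gt1 p_pr.
  have pF : p%:R != 0 :> {poly {poly int}}.
    by rewrite -!polyC_natr !polyC_eq0 pnatr_eq0; case: (p) p_gt1.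
  have lt_km : (k < m)%N by apply: leq_trans le_nm; rewrite Dn ltn_Pmulr.
  have Ek : norm2 x1 y1 z1 w1 = k%:R ^+ 2 * g.
    apply: (mulfI pF); apply: (mulfI pF).
    transitivity (norm2 x y z w).
      by rewrite Ex Ey Ez Ew /norm2 /normform; ring.
    by rewrite En Dn natrM; ring.
  have [R [S [T [W [P [ER ES ET EW]]]]]] := IHm _ _ _ _ _ _ lt_km k_gt0 Ek.
  exists R, S, T, W, P; rewrite Dn natrM.
  have mulp2 (f h : {poly {poly int}}) : f = p%:R * h -> 2 * f = p%:R * (2 * h).
    by move->; ring.
  by split; rewrite -mulrA mulrCA -?(ER, ES, ET, EW); apply: mulp2.
have [n1 | n_neq1] := eqVneq n 1%N.
  by exists x, y, z, w, 0; rewrite n1; split; ring.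
have n_gt1 : (1 < n)%N by rewrite ltn_neqAle eq_sym n_neq1.
have [p_odd | p_even] := boolP (odd (max_pdiv n)).
  apply: (IHdvd _ (max_pdiv_prime n_gt1) (max_pdiv_dvd n)).
  have [k Dn] := dvdnP (max_pdiv_dvd n).
  apply: (@norm2_odd_prime _ _ _ _ _ (k%:R ^+ 2 * (max_pdiv n)%:R * g)) => //.
    exact: max_pdiv_prime.
  by rewrite En {1}Dn natrM; ring.
(* The largest prime factor being 2, n is a power of 2. *)
have Dp2 : max_pdiv n = 2%N.
  by have [//|p_odd] := even_prime (max_pdiv_prime n_gt1); rewrite p_odd in p_even.
have n2 : (2 %| n)%N by rewrite -Dp2 max_pdiv_dvd.
have [k Dn] := dvdnP n2.
have [k1 | k_neq1] := eqVneq k 1%N.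
  have [|R [S [T [W [P [-> -> -> ->]]]]]] := @norm2_dvd4 x y z w g.
    by rewrite En Dn k1 mul1n; ring.
  by exists R, S, T, W, P; rewrite Dn k1 mul1n.
have k_gt1 : (1 < k)%N by lia.
have k2 : (2 %| k)%N.
  have -> : 2%N = pdiv k.
    apply/eqP; rewrite eqn_leq prime_gt1 ?pdiv_prime //=.
    rewrite -[leqRHS]Dp2 max_pdiv_max // mem_primes pdiv_prime // n_gt0 Dn.
    by rewrite dvdn_mulr ?pdiv_dvd.
  exact: pdiv_dvd.
apply: (IHdvd _ _ n2) => //.
have [l Dk] := dvdnP k2.
apply: (@norm2_dvd16 _ _ _ _ (l%:R ^+ 2 * g)).
by rewrite En Dn Dk !natrM; ring.
Qed.

(** * Complete integral closure *)

(** The fraction p / q is almost integral: d (p/q)^n has no denominator. *)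
Definition completely_integrally_closed (D : idomainType) :=
  forall p q d : D, q != 0 -> d != 0 ->
  (forall n, exists r, d * p ^+ n = r * q ^+ n) -> exists r, p = r * q.

Lemma int_completely_integrally_closed : completely_integrally_closed int.
Proof.
move=> p q d q0 d0 dpq; apply/dvdzP.
have g0 : gcdz p q != 0 by rewrite gcdz_eq0 negb_and q0 orbT.
have /dvdzP[p1 Ep] := dvdz_gcdl p q; have /dvdzP[q1 Eq] := dvdz_gcdr p q.
have co : coprimez p1 q1.
  apply/eqP/(mulIf g0); rewrite mul1r.
  by have := mulz_gcdl p1 q1 (gcdz p q); rewrite /= -Ep -Eq.
have dvd_d n : (q1 ^+ n %| d)%Z.
  have [r Er] := dpq n.
  have co_n : coprimez (q1 ^+ n) (p1 ^+ n).
    by rewrite coprimezXl // coprimezXr // coprimez_sym.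
  rewrite -(Gauss_dvdzl _ co_n); apply/dvdzP; exists r.
  have gn0 : gcdz p q ^+ n != 0 by rewrite expf_neq0.
  by apply: (mulIf gn0); rewrite -!mulrA -!exprMn -Ep -Eq.
have : (`|q1| <= 1)%N.
  rewrite leqNgt; apply/negP => q1_gt1.
  have := dvd_d `|d|%N; rewrite dvdzE abszX => /dvdn_leq.
  by rewrite absz_gt0 d0 leqNgt ltn_expl // => /(_ isT).
have [|q1_gt0 q1_le1] := posnP `|q1|%N.
  by move/eqP; rewrite absz_eq0 => /eqP q10; rewrite Eq q10 mul0r eqxx in q0.
have q1_1 : `|q1|%N = 1%N by apply/eqP; rewrite eqn_leq q1_le1.
by rewrite Eq dvdzE abszM q1_1 mul1n -dvdzE dvdz_gcdl.
Qed.

Section PolyClosed.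

Variable D : idomainType.
Implicit Types f g h d r : {poly D}.

(** Over the fraction field of D, polynomials form a principal ideal domain:
    for g1 the cofactor of g in gcd(f, g), every power of g1 divides d, so g1 has
    degree 0. Pseudo-division expresses divisibility over the fraction field by
    the constant c. *)
Lemma poly_almost_integral_pdvd f g d :
  g != 0 -> d != 0 -> (forall n, exists r, d * f ^+ n = r * g ^+ n) ->
  exists2 c, c != 0 & exists r, c%:P * f = r * g.
Proof.
move=> g0 d0 dfg; set h := gcdp f g.
have h0 : h != 0 by rewrite gcdp_eq0 negb_and g0 orbT.
have := dvdp_gcdl f g; rewrite Pdiv.Idomain.dvdp_eq -/h.
set cf := _ ^+ _ => /eqP Ef.
have := dvdp_gcdr f g; rewrite Pdiv.Idomain.dvdp_eq -/h.
set cg := _ ^+ _ => /eqP Eg.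
have cf0 : cf != 0 by rewrite expf_neq0 ?lead_coef_eq0.
have cg0 : cg != 0 by rewrite expf_neq0 ?lead_coef_eq0.
have co : coprimep (f %/ h) (g %/ h) by rewrite coprimep_div_gcd // g0 orbT.
move: (f %/ h) (g %/ h) Ef Eg co => f1 g1 Ef Eg co.
have g10 : g1 != 0.
  apply: contraNneq g0 => g10.
  by rewrite -size_poly_eq0 -(size_scale g cg0) Eg g10 mul0r size_poly0.
have dvd_d n : g1 ^+ n %| d.
  have [r Er] := dfg n.
  have co_n : coprimep (g1 ^+ n) (f1 ^+ n).
    by rewrite coprimep_expl // coprimep_expr // coprimep_sym.
  rewrite -(Gauss_dvdpl _ co_n) -(dvdpZr _ _ (expf_neq0 n cg0)).
  apply/Pdiv.Idomain.dvdpP; exists (1, cf ^+ n *: r); rewrite ?oner_eq0 //= scale1r.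
  have hn0 : h ^+ n != 0 by rewrite expf_neq0.
  apply: (mulIf hn0); rewrite -!scalerAl -!mulrA -!exprMn -Ef -Eg !exprZn.
  by rewrite -!scalerAr Er !scalerA mulrC.
have sz1 : size g1 = 1%N.
  have le_d := dvdp_leq d0 (dvd_d (size d)).
  have pow_gt0 : (0 < size (g1 ^+ size d))%N by rewrite size_poly_gt0 expf_neq0.
  have := size_exp g1 (size d); have : (0 < size g1)%N by rewrite size_poly_gt0.
  case: (size g1) => [|[|k]] // _ Ek.
  by move: le_d; rewrite -(prednK pow_gt0) Ek /= mulSn -addSn leqNgt ltnS leq_addr.
have [e e0 Eg1] : exists2 e, e != 0 & g1 = e%:P by apply/size_poly1P/eqP.
exists (e * cf); first by rewrite mulf_neq0.
exists (cg *: f1); rewrite polyCM -mulrA [cf%:P * f]mul_polyC Ef mulrCA -Eg1 -Eg.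
by rewrite -scalerAr -scalerAl.
Qed.

Hypothesis D_closed : completely_integrally_closed D.

(** Leading coefficients satisfy the same divisibilities in D, so c divides the
    leading coefficient of f. Subtracting the leading term, a multiple of c,
    keeps the hypothesis by the binomial formula. *)
Lemma polyC_almost_dvd (c : D) f d :
  c != 0 -> d != 0 -> (forall n, exists r, d * f ^+ n = r * c%:P ^+ n) ->
  exists r, f = r * c%:P.
Proof.
move=> c0 d0; have [m] := ubnP (size f); elim: m f => // m IHm f lt_fm dfc.
have [-> | f0] := eqVneq f 0; first by exists 0; rewrite mul0r.
have [b Eb] : exists b, lead_coef f = b * c.
  apply: (D_closed c0 (d := lead_coef d)); first by rewrite lead_coef_eq0.
  move=> n; have [r] := dfc n; move/(congr1 (@lead_coef D)).
  by rewrite !lead_coefM !lead_coef_exp lead_coefC; exists (lead_coef r).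
pose top := (b *: 'X^((size f).-1)) * c%:P.
have [||r Er] := IHm (f - top).
- apply: leq_trans (_ : (size f <= m)%N) => //.
  rewrite -[leqRHS]prednK ?size_poly_gt0 // ltnS; apply/leq_sizeP => j le_j.
  rewrite coefB coefMC coefZ coefXn; have [-> | ne_j] := eqVneq.
    by rewrite mulr1 -Eb subrr.
  rewrite mulr0 mul0r subr0 nth_default // -[leqLHS]prednK ?size_poly_gt0 //.
  by rewrite ltn_neqAle eq_sym ne_j.
- move=> n; rewrite exprBn mulr_sumr.
  apply: (big_ind (fun h => exists r, h = r * c%:P ^+ n)) => [||i _].
  + by exists 0; rewrite mul0r.
  + by move=> _ _ [r1 ->] [r2 ->]; exists (r1 + r2); rewrite mulrDl.
  have [r Er] := dfc (n - i)%N.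
  exists ((-1) ^+ i * r * (b *: 'X^((size f).-1)) ^+ i *+ 'C(n, i)).
  rewrite mulrnAr mulrnAl; congr (_ *+ _).
  have -> : c%:P ^+ n = c%:P ^+ (n - i) * c%:P ^+ i.
    by rewrite -exprD subnK // -ltnS.
  rewrite exprMn; transitivity ((-1) ^+ i * (d * f ^+ (n - i))
     * (b *: 'X^((size f).-1)) ^+ i * c%:P ^+ i); first by ring.
  by rewrite Er; ring.
exists (r + b *: 'X^((size f).-1)); rewrite mulrDl -Er; exact/esym/subrK.
Qed.

Lemma poly_completely_integrally_closed :
  completely_integrally_closed {poly D}.
Proof.
move=> f g d g0 d0 dfg.
have [c c0 [r Er]] := poly_almost_integral_pdvd g0 d0 dfg.
have [|r1 Er1] := @polyC_almost_dvd c r d c0 d0.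
  move=> n; have [s Es] := dfg n; exists s.
  have gn0 : g ^+ n != 0 by rewrite expf_neq0.
  by apply: (mulIf gn0); rewrite -mulrA -exprMn -Er exprMn mulrCA Es; ring.
have cP0 : c%:P != 0 :> {poly D} by rewrite polyC_eq0.
by exists r1; apply: (mulfI cP0); rewrite Er Er1; ring.
Qed.

End PolyClosed.

(** * The lattice description *)

Lemma Zuv_Quv_u : Zuv_Quv 'X%:P = 'X%:P.
Proof. by rewrite /= map_polyC /= map_polyX. Qed.

Lemma Zuv_Quv_v : Zuv_Quv 'X = 'X.
Proof. by rewrite /= map_polyX. Qed.

Lemma ofZuv_u : ofZuv 'X%:P = ivar_u.
Proof. by rewrite -[LHS]/(ofQuv (Zuv_Quv _)) Zuv_Quv_u. Qed.

Lemma ofZuv_v : ofZuv 'X = ivar_v.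
Proof. by rewrite -[LHS]/(ofQuv (Zuv_Quv _)) Zuv_Quv_v. Qed.

Lemma QQuv_nat_neq0 n : (0 < n)%N -> n%:R != 0 :> QQuv.
Proof.
move=> n_gt0; rewrite -(rmorph_nat ofQuv) /= tofrac_eq0 -!polyC_natr !polyC_eq0.
by rewrite pnatr_eq0 -lt0n.
Qed.

Lemma ofQuv_half : ofQuv ((2^-1)%:P)%:P = 2^-1.
Proof.
have nz2 : 2 != 0 :> QQuv by exact: QQuv_nat_neq0.
apply: (mulfI nz2); rewrite divff // -[2]/(2%:R) -(rmorph_nat ofQuv) -rmorphM.
by rewrite -!polyC_natr -!polyCM divff ?rmorph1.
Qed.

Lemma quat_norm_ofQuv (R S T W : Quv) :
  quat_norm (mkQ (ofQuv R) (ofQuv S) (ofQuv T) (ofQuv W)) = ofQuv (norm2 R S T W).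
Proof.
symmetry; rewrite /norm2 /normform.
by rewrite !(rmorphD, rmorphN, rmorphM, rmorphXn, rmorph1).
Qed.

Lemma rat_poly_clear_nat_denom (c : {poly rat}) :
  exists2 n, (0 < n)%N &
    exists r : {poly int}, map_poly (intr : int -> rat) r = n%:R * c.
Proof.
have [r [a a0 ->]] := rat_poly_scale c.
have a_rat0 : a%:~R != 0 :> rat by rewrite intr_eq0.
exists `|a|%N; first by rewrite absz_gt0.
exists ((sgz a)%:P * r); rewrite rmorphM /= map_polyC /=.
rewrite -scalerAr mulr_natl -scaler_nat scalerA -mul_polyC; congr (_%:P * _).
apply: (mulIf a_rat0).
by rewrite mulrAC mulVf // mul1r -intrM -abszEsg -pmulrn.
Qed.

(** The denominator must be an integer, not a polynomial: the induction over
    primes in [norm2_dvd_sqr] only removes integers. *)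
Lemma Quv_clear_nat_denom (f : Quv) :
  exists2 n, (0 < n)%N & exists g : Zuv, Zuv_Quv g = n%:R * f.
Proof.
elim/poly_ind: f => [|f c [n n_gt0 [g Eg]]].
  by exists 1%N => //; exists 0; rewrite mulr0 rmorph0.
have [m m_gt0 [r Er]] := rat_poly_clear_nat_denom c.
exists (n * m)%N; first by rewrite muln_gt0 n_gt0.
exists (m%:R * g * 'X + n%:R * r%:P).
have ErP : Zuv_Quv r%:P = m%:R * c%:P.
  by rewrite /= map_polyC /= Er rmorphM rmorph_nat.
rewrite rmorphD !rmorphM !rmorph_nat Zuv_Quv_v Eg ErP ?natrM; ring.
Qed.

Definition half_gen : calQ :=
  2^-1 *: mkQ ((ivar_u + 1) * (ivar_v + 1)) (ivar_v + 1) (ivar_u + 1) 1.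

Definition lattice_pt (R S T W P : Zuv) : calQ :=
  mkQ (ofZuv R) (ofZuv S) (ofZuv T) (ofZuv W)
           + (2^-1 * ofZuv P)
             *: mkQ ((ivar_u + 1) * (ivar_v + 1)) (ivar_v + 1) (ivar_u + 1) 1.

Lemma calO_half_lattice :
  calO `<=` [set x | exists R S T W P, x = lattice_pt R S T W P].
Proof.
move=> _ [R [S [T [W [-> [p Ep]]]]]] /=.
have [n1 n1_gt0 [R1 ER1]] := Quv_clear_nat_denom R.
have [n2 n2_gt0 [S1 ES1]] := Quv_clear_nat_denom S.
have [n3 n3_gt0 [T1 ET1]] := Quv_clear_nat_denom T.
have [n4 n4_gt0 [W1 EW1]] := Quv_clear_nat_denom W.
pose n := (n1 * n2 * n3 * n4)%N.
have n_gt0 : (0 < n)%N by rewrite !muln_gt0 n1_gt0 n2_gt0 n3_gt0.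
have clear f : (exists g, Zuv_Quv g = n%:R * f) ->
    exists2 g, Zuv_Quv g = n%:R * f & ofZuv g = n%:R * ofQuv f.
  move=> [g Eg]; exists g => //.
  by rewrite -[LHS]/(ofQuv (Zuv_Quv g)) Eg rmorphM rmorph_nat.
have [R2 ER2 FR] : exists2 g, Zuv_Quv g = n%:R * R & ofZuv g = n%:R * ofQuv R.
  apply: clear; exists ((n2 * n3 * n4)%:R * R1).
  by rewrite rmorphM rmorph_nat ER1 /n !natrM; ring.
have [S2 ES2 FS] : exists2 g, Zuv_Quv g = n%:R * S & ofZuv g = n%:R * ofQuv S.
  apply: clear; exists ((n1 * n3 * n4)%:R * S1).
  by rewrite rmorphM rmorph_nat ES1 /n !natrM; ring.
have [T2 ET2 FT] : exists2 g, Zuv_Quv g = n%:R * T & ofZuv g = n%:R * ofQuv T.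
  apply: clear; exists ((n1 * n2 * n4)%:R * T1).
  by rewrite rmorphM rmorph_nat ET1 /n !natrM; ring.
have [W2 EW2 FW] : exists2 g, Zuv_Quv g = n%:R * W & ofZuv g = n%:R * ofQuv W.
  apply: clear; exists ((n1 * n2 * n3)%:R * W1).
  by rewrite rmorphM rmorph_nat EW1 /n !natrM; ring.
clearbody n.
have EN : norm2 R S T W = Zuv_Quv p.
  by apply/eqP; rewrite -tofrac_eq; apply/eqP; rewrite -[LHS]quat_norm_ofQuv.
have EN2 : norm2 R2 S2 T2 W2 = n%:R ^+ 2 * p.
  apply: Zuv_Quv_inj; rewrite [LHS]norm2_map rmorphM rmorphXn rmorph_nat -EN.
  rewrite -[norm2 _ _ _ _]/
    (norm2 (Zuv_Quv _) (Zuv_Quv _) (Zuv_Quv _) (Zuv_Quv _)).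
  by rewrite ER2 ES2 ET2 EW2 /norm2 /normform; ring.
have [R0 [S0 [T0 [W0 [P [ER ES ET EW]]]]]] := norm2_dvd_sqr n_gt0 EN2.
exists R0, S0, T0, W0, P.
have nF : n%:R != 0 :> QQuv by exact: QQuv_nat_neq0.
have F2 : 2 != 0 :> QQuv by exact: QQuv_nat_neq0.
have half (f : Quv) (g h e : Zuv) : 2 * g = n%:R * (2 * h + P * e) ->
    ofZuv g = n%:R * ofQuv f -> ofQuv f = ofZuv h + 2^-1 * ofZuv P * ofZuv e.
  move=> /(congr1 ofZuv); rewrite !(rmorphM, rmorphD, rmorph_nat) => E Ef.
  apply: (mulfI nF); rewrite -Ef; apply: (mulfI F2); rewrite E.
  by field.
rewrite (half _ _ _ _ ER FR) (half _ _ _ _ ES FS) (half _ _ _ _ ET FT).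
rewrite (half _ _ W0 1 _ FW) ?mulr1 //.
by rewrite !(rmorphM, rmorphD, rmorph1) ofZuv_u ofZuv_v.
Qed.

Lemma half_lattice_calO (R S T W P : Zuv) :
  calO (lattice_pt R S T W P).
Proof.
have F2 : 2 != 0 :> QQuv by exact: QQuv_nat_neq0.
pose s : Zuv := 'X%:P + 1; pose t : Zuv := 'X + 1.
pose hP : Quv := ((2^-1)%:P)%:P * Zuv_Quv P.
exists (Zuv_Quv R + hP * Zuv_Quv (s * t)), (Zuv_Quv S + hP * Zuv_Quv t),
  (Zuv_Quv T + hP * Zuv_Quv s), (Zuv_Quv W + hP).
have EhP : ofQuv hP = 2^-1 * ofZuv P by rewrite rmorphM ofQuv_half.
have Es : ofZuv s = ivar_u + 1 by rewrite rmorphD rmorph1 ofZuv_u.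
have Et : ofZuv t = ivar_v + 1 by rewrite rmorphD rmorph1 ofZuv_v.
have ofZE f : ofQuv (Zuv_Quv f) = ofZuv f by [].
split.
  rewrite !(rmorphD ofQuv) !(rmorphM ofQuv hP) EhP !ofZE !(rmorphM ofZuv s) Es Et.
  apply/quatP; split=> //.
  by rewrite -[RHS]/(ofZuv W + 2^-1 * ofZuv P) -[X in _ = _ + X]mulr1.
rewrite /lattice_pt.
(* With m = (R,S,T,W), N(m + P/2 e) is N(m) plus P/2 times the polar form of
   (m, e), which is even, plus P^2 N(e)/4 = P^2 st. *)
exists (norm2 R S T W + P * (R * (s * t) - ('X%:P ^+ 2 - 1) * S * t
   - ('X ^+ 2 - 1) * T * s + ('X%:P ^+ 2 - 1) * ('X ^+ 2 - 1) * W)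
   + P ^+ 2 * (s * t)).
rewrite /norm2 /normform !(rmorphD, rmorphN, rmorphM ofZuv, rmorphXn, rmorph1).
rewrite ofZuv_u ofZuv_v.
move: (ofZuv R) (ofZuv S) (ofZuv T) (ofZuv W) (ofZuv P) => x y z w p.
by rewrite /quat_norm /=; field.
Qed.

(** * The lattice is an order *)

Lemma lattice_ptD R S T W P R' S' T' W' P' :
  lattice_pt R S T W P + lattice_pt R' S' T' W' P' =
  lattice_pt (R + R') (S + S') (T + T') (W + W') (P + P').
Proof.
rewrite /lattice_pt !(rmorphD ofZuv).
move: (ofZuv R) (ofZuv S) (ofZuv T) (ofZuv W) (ofZuv P) => x y z w p.
move: (ofZuv R') (ofZuv S') (ofZuv T') (ofZuv W') (ofZuv P') => x' y' z' w' p'.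
by apply/quatP; split=> /=; ring.
Qed.

Lemma lattice_ptZ c R S T W P :
  ofZuv c *: lattice_pt R S T W P =
  lattice_pt (c * R) (c * S) (c * T) (c * W) (c * P).
Proof.
rewrite /lattice_pt !(rmorphM ofZuv).
move: (ofZuv R) (ofZuv S) (ofZuv T) (ofZuv W) (ofZuv P) (ofZuv c) => x y z w p d.
by apply/quatP; split=> /=; ring.
Qed.

Lemma lattice_ptE R S T W P :
  lattice_pt R S T W P = ofZuv R *: 1 + (ofZuv S *: quat_i _ _ +
    (ofZuv T *: quat_j _ _ + (ofZuv W *: quat_k _ _ + ofZuv P *: half_gen))).
Proof.
rewrite /lattice_pt.
move: (ofZuv R) (ofZuv S) (ofZuv T) (ofZuv W) (ofZuv P) => x y z w p.
by apply/quatP; split=> /=; ring.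
Qed.

Lemma calO_basis :
  [/\ calO 1, calO (quat_i _ _), calO (quat_j _ _) & calO (quat_k _ _)].
Proof.
have coord (c0 c1 c2 c3 : Zuv) (x0 x1 x2 x3 : QQuv) : ofZuv c0 = x0 ->
    ofZuv c1 = x1 -> ofZuv c2 = x2 -> ofZuv c3 = x3 -> calO (mkQ x0 x1 x2 x3).
  move=> <- <- <- <-; have := half_lattice_calO c0 c1 c2 c3 0.
  by rewrite /lattice_pt (rmorph0 ofZuv) mulr0 scale0r addr0.
have [E1 E0] := (rmorph1 ofZuv, rmorph0 ofZuv).
split.
- exact: (coord 1 0 0 0 1 0 0 0).
- exact: (coord 0 1 0 0 0 1 0 0).
- exact: (coord 0 0 1 0 0 0 1 0).
- exact: (coord 0 0 0 1 0 0 0 1).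
Qed.

Lemma quat_normM (F : fieldType) (a b : F) (x y : quat a b) :
  quat_norm (x * y) = quat_norm x * quat_norm y.
Proof. by case: x y => [? ? ? ?] [? ? ? ?]; rewrite /quat_norm /=; ring. Qed.

Lemma calO_mul x y : calO x -> calO y -> calO (x * y).
Proof.
move=> [x0 [x1 [x2 [x3 [Ex [p Ep]]]]]] [y0 [y1 [y2 [y3 [Ey [q Eq]]]]]].
have [a Ea] : exists a, ofQuv a = ivar_u ^+ 2 - 1.
  by exists ('X%:P ^+ 2 - 1); rewrite rmorphB rmorphXn rmorph1.
have [b Eb] : exists b, ofQuv b = ivar_v ^+ 2 - 1.
  by exists ('X ^+ 2 - 1); rewrite rmorphB rmorphXn rmorph1.
exists (x0 * y0 + a * x1 * y1 + b * x2 * y2 - a * b * x3 * y3),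
  (x0 * y1 + x1 * y0 - b * x2 * y3 + b * x3 * y2),
  (x0 * y2 + x2 * y0 + a * x1 * y3 - a * x3 * y1),
  (x0 * y3 + x3 * y0 + x1 * y2 - x2 * y1); split.
  rewrite Ex Ey.
  rewrite !(rmorphD ofQuv, rmorphN ofQuv, rmorphM ofQuv) Ea Eb.
  by apply/quatP.
by exists (p * q); rewrite quat_normM Ep Eq rmorphM.
Qed.

Lemma quat_coord (F : fieldType) (a b : F) (x : quat a b) :
  x = \sum_(i < 4) tnth [tuple qre x; qi_ x; qj_ x; qk_ x] i *:
        tnth [tuple 1; quat_i _ _; quat_j _ _; quat_k _ _] i.
Proof.
rewrite !big_ord_recl big_ord0 !(tnth_nth 0) /= addr0.
by case: x => x y z w; apply/quatP; split=> /=; ring.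
Qed.

Lemma calO_order : is_order ofZuv calO.
Proof.
have [O1 Oi Oj Ok] := calO_basis.
have calOZ (c : Zuv) x : calO x -> calO (ofZuv c *: x).
  move=> /calO_half_lattice[R [S [T [W [P ->]]]]]; rewrite lattice_ptZ.
  exact: half_lattice_calO.
split.
- split; last exact: calOZ.
    by have := calOZ 0 1 O1; rewrite rmorph0 scale0r.
  move=> x y /calO_half_lattice[R [S [T [W [P ->]]]]].
  move=> /calO_half_lattice[R' [S' [T' [W' [P' ->]]]]]; rewrite lattice_ptD.
  exact: half_lattice_calO.
- exists 5%N, (tnth [tuple 1; quat_i _ _; quat_j _ _; quat_k _ _; half_gen]).
  apply/seteqP; split=> x /=.
    move=> /calO_half_lattice[R [S [T [W [P ->]]]]].
    exists (tnth [tuple R; S; T; W; P]).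
    by rewrite lattice_ptE !big_ord_recl big_ord0 addr0.
  move=> [c ->]; rewrite !big_ord_recl big_ord0 addr0.
  by rewrite -[X in calO X]lattice_ptE; apply: half_lattice_calO.
- apply/seteqP; split=> // x _; exists 4%N.
  exists (tnth [tuple qre x; qi_ x; qj_ x; qk_ x]).
  exists (tnth [tuple 1; quat_i _ _; quat_j _ _; quat_k _ _]); split.
    case=> [[|[|[|[|m]]]] lt_i]; rewrite (tnth_nth 0);
      [exact: O1 | exact: Oi | exact: Oj | exact: Ok | by []].
  exact: quat_coord.
- exact: O1.
- exact: calO_mul.
Qed.

(** * Orders containing i and j *)

Lemma dvd_X2sub1 (D : idomainType) (p : {poly D}) :
  2 != 0 :> D -> root p 1 -> root p (- 1) -> exists q, p = q * ('X^2 - 1).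
Proof.
move=> D2 /factor_theorem[q ->]; rewrite rootE hornerM -polyC1 !horner_ringE.
rewrite mulf_eq0 -opprD oppr_eq0 (negPf D2) orbF => /factor_theorem[r ->].
by exists r; rewrite polyCN; ring.
Qed.

(** At v = 1 and v = -1 the right-hand side vanishes and the left-hand side
    becomes (u^2 - 1) z^2 - w^2. *)
Lemma dvd_binary_form (D : idomainType) (z w g : {poly {poly D}}) :
  2 != 0 :> D ->
  ('X%:P ^+ 2 - 1) * z ^+ 2 - w ^+ 2 = ('X^2 - 1) * g ->
  exists z1 w1, z = z1 * ('X^2 - 1) /\ w = w1 * ('X^2 - 1).
Proof.
move=> D2 E.
have P2 : 2 != 0 :> {poly D} by rewrite -polyC_natr polyC_eq0.
have at_root c : c ^+ 2 = 1 -> root z c /\ root w c.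
  move=> c2; have /(congr1 (fun h : {poly {poly D}} => h.[c])) := E.
  rewrite -polyC1 -polyC_exp -polyCB !horner_ringE c2 subrr mul0r.
  move/eqP; rewrite subr_eq0 ?polyC1 => /eqP/(X2sub1_nonsquare D2)[z0 w0].
  by rewrite !rootE z0 w0.
have [z_1 w_1] := at_root 1 (expr1n _ _).
have [z_N1 w_N1] : root z (- 1) /\ root w (- 1).
  by apply: at_root; rewrite sqrrN expr1n.
have [z1 Ez] := dvd_X2sub1 P2 z_1 z_N1; have [w1 Ew] := dvd_X2sub1 P2 w_1 w_N1.
by exists z1, w1.
Qed.

(** Modulo v^2 - 1 the first term vanishes, so v^2 - 1 divides z and w. Dividing
    the identity by v^2 - 1 gives one of the same shape, with u and v exchanged,
    for y and the cofactor of w. *)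
Lemma dvd_ternary_form (D : idomainType) (y z w g : {poly {poly D}}) :
  2 != 0 :> D ->
  ('X^2 - 1) * y ^+ 2 + ('X%:P ^+ 2 - 1) * z ^+ 2 - w ^+ 2
    = ('X%:P ^+ 2 - 1) * ('X^2 - 1) * g ->
  exists y1 z1 w1, [/\ y = ('X%:P ^+ 2 - 1) * y1, z = ('X^2 - 1) * z1 &
    w = ('X%:P ^+ 2 - 1) * ('X^2 - 1) * w1].
Proof.
move=> D2 E.
have nz : 'X^2 - 1 != 0 :> {poly {poly D}}.
  by rewrite -size_poly_eq0 -polyC1 size_XnsubC.
have [z1 [w1 [Ez Ew]]] : exists z1 w1, z = z1 * ('X^2 - 1) /\ w = w1 * ('X^2 - 1).
  apply: (dvd_binary_form (g := ('X%:P ^+ 2 - 1) * g - y ^+ 2) D2).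
  transitivity (('X%:P ^+ 2 - 1) * ('X^2 - 1) * g - ('X^2 - 1) * y ^+ 2).
    by rewrite -E; ring.
  by ring.
have E1 : ('X^2 - 1) * w1 ^+ 2 - y ^+ 2
        = ('X%:P ^+ 2 - 1) * (('X^2 - 1) * z1 ^+ 2 - g).
  apply: (mulfI nz); transitivity (('X%:P ^+ 2 - 1) * z ^+ 2 -
    (('X^2 - 1) * y ^+ 2 + ('X%:P ^+ 2 - 1) * z ^+ 2 - w ^+ 2)).
    by rewrite Ew; ring.
  by rewrite E Ez; ring.
have swapX2 : swapXY ('X^2 - 1) = 'X%:P ^+ 2 - 1 :> {poly {poly D}}.
  by rewrite rmorphB rmorphXn rmorph1 /= swapXY_X.
have swapY2 : swapXY ('X%:P ^+ 2 - 1) = 'X^2 - 1 :> {poly {poly D}}.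
  by rewrite rmorphB rmorphXn rmorph1 /= swapXY_Y.
have [w2 [y2 [Ew1 Ey]]] : exists w2 y2,
    swapXY w1 = w2 * ('X^2 - 1) /\ swapXY y = y2 * ('X^2 - 1).
  apply: (dvd_binary_form (g := swapXY (('X^2 - 1) * z1 ^+ 2 - g)) D2).
  have /(congr1 swapXY) := E1.
  by rewrite rmorphB rmorphM rmorphXn rmorphXn [RHS]rmorphM /= swapX2 swapY2.
exists (swapXY y2), z1, (swapXY w2); split.
- by rewrite -[y]swapXYK Ey rmorphM /= swapX2 mulrC.
- by rewrite Ez mulrC.
by rewrite Ew -[w1]swapXYK Ew1 rmorphM /= swapX2; ring.
Qed.

Lemma QQuv_almost_integral (d : Zuv) (x : QQuv) :
  d != 0 -> (forall n, exists r, ofZuv d * x ^+ n = ofZuv r) ->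
  exists p, x = ofZuv p.
Proof.
move=> d0; have [p [q [q0 ->]]] := ofZuv_frac x.
have qF : ofZuv q != 0 by rewrite -(rmorph0 ofZuv) (inj_eq ofZuv_inj).
move=> dpq.
have closed : completely_integrally_closed Zuv.
  do 2!apply: poly_completely_integrally_closed.
  exact: int_completely_integrally_closed.
have [n|r ->] := closed p q d q0 d0; last first.
  by exists r; rewrite rmorphM mulfK.
have [r Er] := dpq n; exists r; apply: ofZuv_inj.
rewrite !rmorphM !rmorphXn -Er exprMn exprVn mulrA.
by symmetry; apply: divfK; exact: expf_neq0.
Qed.

Lemma common_denominator (s : seq QQuv) :
  exists2 d : Zuv, d != 0 & forall x, x \in s -> exists p, ofZuv d * x = ofZuv p.
Proof.
elim: s => [|y s [d d0 IHs]]; first by exists 1; rewrite ?oner_neq0.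
have [p [q [q0 Ey]]] := ofZuv_frac y.
have qF : ofZuv q != 0 by rewrite -(rmorph0 ofZuv) (inj_eq ofZuv_inj).
exists (d * q); first by rewrite mulf_neq0.
move=> x; rewrite inE => /predU1P[-> | /IHs[r Er]].
  by exists (d * p); rewrite Ey !(rmorphM ofZuv) -mulrA [ofZuv q * _]mulrC divfK.
by exists (q * r); rewrite !(rmorphM ofZuv) mulrAC Er mulrC.
Qed.

Definition Zuv_coord (x : calQ) :=
  exists R S T W, x = mkQ (ofZuv R) (ofZuv S) (ofZuv T) (ofZuv W).

Lemma fingen_denominator (M : set calQ) :
  finitely_generated ofZuv M ->
  exists2 d : Zuv, d != 0 & forall x, M x -> Zuv_coord (ofZuv d *: x).
Proof.
move=> [n [g ->]].
pose coords := [seq tnth [tuple qre (g i); qi_ (g i); qj_ (g i); qk_ (g i)] j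
               | i <- enum 'I_n, j <- enum 'I_4].
have [d d0 dP] := common_denominator coords.
exists d => // _ [c ->]; rewrite scaler_sumr.
apply: (big_ind Zuv_coord) => [|x y|i _].
- by exists 0, 0, 0, 0; rewrite (rmorph0 ofZuv).
- move=> [R [S [T [W ->]]]] [R' [S' [T' [W' ->]]]].
  by exists (R + R'), (S + S'), (T + T'), (W + W'); rewrite !(rmorphD ofZuv).
have dgi j : exists p,
    ofZuv d * tnth [tuple qre (g i); qi_ (g i); qj_ (g i); qk_ (g i)] j = ofZuv p.
  by apply: dP; apply: allpairs_f; rewrite mem_enum.
have [R ER] := dgi (@Ordinal 4 0 isT); have [S ES] := dgi (@Ordinal 4 1 isT).
have [T ET] := dgi (@Ordinal 4 2 isT); have [W EW] := dgi (@Ordinal 4 3 isT).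
exists (c i * R), (c i * S), (c i * T), (c i * W).
by rewrite !(rmorphM ofZuv) -ER -ES -ET -EW scalerA mulrC -scalerA.
Qed.

Lemma quat_normZ (F : fieldType) (a b c : F) (x : quat a b) :
  quat_norm (c *: x) = c ^+ 2 * quat_norm x.
Proof. by case: x => *; rewrite /quat_norm /=; ring. Qed.

Lemma quat_normX (F : fieldType) (a b : F) (x : quat a b) n :
  quat_norm (x ^+ n) = quat_norm x ^+ n.
Proof.
elim: n => [|n IHn]; last by rewrite !exprS quat_normM IHn.
by rewrite /quat_norm /=; ring.
Qed.

(** Powers of x stay in M, so d^2 N(x)^n = N(d x^n) is integral for all n. *)
Lemma order_norm (M : set calQ) x :
  is_order ofZuv M -> M x -> exists p, quat_norm x = ofZuv p.
Proof.
move=> [_ /fingen_denominator[d d0 dM] _ M1 MM] Mx.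
have MX n : M (x ^+ n).
  by elim: n => [|n IHn]; [exact: M1 | rewrite exprS; exact: MM].
apply: (@QQuv_almost_integral (d ^+ 2)); first by rewrite expf_neq0.
move=> n; have [R [S [T [W E]]]] := dM _ (MX n).
exists (norm2 R S T W); rewrite rmorphXn -quat_normX -quat_normZ E.
rewrite [LHS](@quat_norm_ofQuv (Zuv_Quv R) (Zuv_Quv S) (Zuv_Quv T) (Zuv_Quv W)).
by rewrite -[norm2 _ _ _ _](@norm2_map int rat intr).
Qed.

(** The trace comes from the norm, so that integrality is only needed for the
    norm, which is multiplicative. *)
Lemma quat_trace_norm (F : fieldType) (a b : F) (x : quat a b) :
  2 * qre x = quat_norm (1 + x) - 1 - quat_norm x.
Proof. by case: x => *; rewrite /quat_norm /=; ring. Qed.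

Lemma order_trace (M : set calQ) x :
  is_order ofZuv M -> M x -> exists p, 2 * qre x = ofZuv p.
Proof.
move=> Mord Mx; have [[_ MD _] _ _ M1 _] := Mord.
have [p Ep] := order_norm Mord Mx.
have [q Eq] := order_norm Mord (MD _ _ M1 Mx).
by exists (q - 1 - p); rewrite quat_trace_norm Ep Eq !rmorphB rmorph1.
Qed.

Lemma half_ofZuv (x : QQuv) (p : Zuv) : 2 * x = ofZuv p -> exists f, x = ofQuv f.
Proof.
move=> Ex; exists (((2^-1)%:P)%:P * Zuv_Quv p); rewrite rmorphM ofQuv_half.
have F2 : 2 != 0 :> QQuv by exact: QQuv_nat_neq0.
by rewrite -[ofQuv (Zuv_Quv p)]/(ofZuv p) -Ex mulrA mulVf // mul1r.
Qed.

Lemma qre_mul_basis (F : fieldType) (a b : F) (x : quat a b) :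
  [/\ qre (x * quat_i _ _) = a * qi_ x, qre (x * quat_j _ _) = b * qj_ x &
      qre (x * quat_k _ _) = - (a * b * qk_ x)].
Proof. by case: x => *; split=> /=; ring. Qed.

(** The traces of x, xi, xj, xk are 2x, 2ay, 2bz, -2abw in coordinates (x,y,z,w).
    With S = ay, T = bz, W = -abw polynomials over Q, the norm equation times ab is
    b S^2 + a T^2 - W^2 = ab (R^2 - N(x)), so [dvd_ternary_form] applies. *)
Lemma order_sub_calO (M : set calQ) :
  is_order ofZuv M -> M (quat_i _ _) -> M (quat_j _ _) -> M `<=` calO.
Proof.
move=> Mord Mi Mj x Mx; have [_ _ _ _ MM] := Mord.
have Mk : M (quat_k _ _) by rewrite -quat_ij; apply: MM.
have [a Da Ea] : exists2 a : Quv, a = 'X%:P ^+ 2 - 1 & ofQuv a = ivar_u ^+ 2 - 1.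
  by exists ('X%:P ^+ 2 - 1); rewrite // rmorphB rmorphXn rmorph1.
have [b Db Eb] : exists2 b : Quv, b = 'X ^+ 2 - 1 & ofQuv b = ivar_v ^+ 2 - 1.
  by exists ('X ^+ 2 - 1); rewrite // rmorphB rmorphXn rmorph1.
have half_coord y : M y -> exists f, qre y = ofQuv f.
  by move=> /(order_trace Mord)[p /half_ofZuv].
have [n En] := order_norm Mord Mx.
have [R ER] := half_coord _ Mx.
have [S ES] := half_coord _ (MM _ _ Mx Mi).
have [T ET] := half_coord _ (MM _ _ Mx Mj).
have [W EW] := half_coord _ (MM _ _ Mx Mk).
case: x Mx En ER ES ET EW => x y z w Mx En ER ES ET EW.
have [Ei Ej Ek] :=
  qre_mul_basis (Quat (ivar_u ^+ 2 - 1) (ivar_v ^+ 2 - 1) x y z w).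
have {}ES : ofQuv a * y = ofQuv S by rewrite Ea -ES; exact/esym/Ei.
have {}ET : ofQuv b * z = ofQuv T by rewrite Eb -ET; exact/esym/Ej.
have {}EW : - (ofQuv a * ofQuv b * w) = ofQuv W.
  by rewrite Ea Eb -EW; exact/esym/Ek.
have {}ER : x = ofQuv R by exact: ER.
have Nx : x ^+ 2 - ofQuv a * y ^+ 2 - ofQuv b * z ^+ 2
    + ofQuv a * ofQuv b * w ^+ 2 = ofQuv (Zuv_Quv n) by rewrite Ea Eb; exact: En.
have E : b * S ^+ 2 + a * T ^+ 2 - W ^+ 2 = a * b * (R ^+ 2 - Zuv_Quv n).
  have ofQuv_inj : injective ofQuv by move=> f g /eqP; rewrite tofrac_eq => /eqP.
  apply: ofQuv_inj; rewrite rmorphB rmorphD !(rmorphM ofQuv) rmorphB !(rmorphXn ofQuv).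
  rewrite -ES -ET -EW -Nx -ER.
  by move: (ofQuv a) (ofQuv b) => a' b'; ring.
have aF : ofQuv a != 0.
  rewrite tofrac_eq0 Da -polyC1 -polyC_exp -polyCB polyC_eq0.
  by rewrite -size_poly_eq0 -polyC1 size_XnsubC.
have bF : ofQuv b != 0.
  by rewrite tofrac_eq0 Db -size_poly_eq0 -polyC1 size_XnsubC.
have [y1 [z1 [w1 [Ey Ez Ew]]]] :
    exists y1 z1 w1, [/\ S = a * y1, T = b * z1 & W = a * b * w1].
  move: E; rewrite Da Db; exact: (dvd_ternary_form (isT : 2 != 0 :> rat)).
exists R, y1, z1, (- w1); split; last by exists n.
rewrite rmorphN; apply/quatP; split.
- exact: ER.
- by apply: (mulfI aF); rewrite -[qi_ _]/y ES Ey rmorphM.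
- by apply: (mulfI bF); rewrite -[qj_ _]/z ET Ez rmorphM.
apply: (mulfI (mulf_neq0 aF bF)); rewrite -[qk_ _]/w -[RHS]/(_ * - ofQuv w1).
by rewrite mulrN -[LHS]opprK EW Ew !(rmorphM ofQuv).
Qed.

Theorem theorem8p1 :
  calO =
    [set x | exists R S T W P : Zuv,
       x = mkQ (ofZuv R) (ofZuv S) (ofZuv T) (ofZuv W)
           + (2^-1 * ofZuv P)
             *: mkQ ((ivar_u + 1) * (ivar_v + 1)) (ivar_v + 1) (ivar_u + 1) 1]
  /\
  [/\ is_maximal_order ofZuv calO,
      calO (quat_i _ _), calO (quat_j _ _) &
      forall M : set calQ,
        is_maximal_order ofZuv M -> M (quat_i _ _) -> M (quat_j _ _) ->
        M = calO].
Proof.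
have [_ Oi Oj _] := calO_basis.
split.
  apply/seteqP; split; first exact: calO_half_lattice.
  by move=> _ [R [S [T [W [P ->]]]]]; apply: half_lattice_calO.
split.
- split; first exact: calO_order.
  move=> M Mord sOM; apply/seteqP; split=> //.
  by apply: order_sub_calO => //; apply: sOM.
- exact: Oi.
- exact: Oj.
move=> M [Mord Mmax] Mi Mj; apply/esym/Mmax; first exact: calO_order.
exact: order_sub_calO.
Qed.
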